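(* Let $n$ be a natural number, let $a_1,\dots,a_n$ be natural numbers (positive integers) that are coprime, i.e. $\gcd(a_1,\dots,a_n)=1$, and let $b$ be a non-negative integer. Let $M$ be the least common multiple of $a_1,\dots,a_n$ and let $r\in\{0,1,\dots,M-1\}$ be the remainder of $b$ modulo $M$. If $$\left\lfloor n-\frac{\sum_{i=1}^{n}a_i+r}{M}\right\rfloor=0,$$ then $$P(r)=\frac{M^{n-1}}{a_1a_2\cdots a_n}\qquad\text{and}\qquad P(b)=\frac{M^{n-1}}{a_1a_2\cdots a_n}\binom{\lfloor b/M\rfloor+n-1}{n-1}.$$
   Context: For an integer $l$, $P(l)$ denotes the number of $n$-tuples $(x_1,\dots,x_n)$ of non-negative integers with $\sum_{i=1}^n a_ix_i=l$. ''Coprime'' means that the greatest common divisor of all the numbers is $1$ (not necessarily pairwise coprime). *)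

(* Defs.v *)
From mathcomp Require Import all_boot all_order all_algebra.

Set Implicit Arguments.
Unset Strict Implicit.
Unset Printing Implicit Defensive.

(* The number P(l) of n-tuples x of non-negative integers such that
   \sum_i a_i * x_i = l. The entries are drawn from {0, ..., l} so that they
   can be counted; when all the a_i are positive no solution is lost, as
   denumerantP shows. *)
Definition denumerant (n : nat) (a : 'I_n -> nat) (l : nat) : nat :=
  #|[set x : {ffun 'I_n -> 'I_l.+1} | \sum_(i < n) a i * x i == l]|.

Lemma denumerantP (n : nat) (a : 'I_n -> nat) (l : nat) :
  (forall i, 0 < a i) ->
  exists s : seq {ffun 'I_n -> nat},
    [/\ uniq s,
        forall x, (x \in s) = (\sum_(i < n) a i * x i == l)
      & size s = denumerant a l].
Proof.
move=> a_gt0; pose A := [set x : {ffun 'I_n -> 'I_l.+1} | \sum_(i < n) a i * x i == l].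
pose f (x : {ffun 'I_n -> 'I_l.+1}) : {ffun 'I_n -> nat} :=
  [ffun i => nat_of_ord (x i)].
have f_inj : injective f.
  by move=> x y /ffunP exy; apply/ffunP => i; apply/val_inj;
     move: (exy i); rewrite !ffunE.
have sum_f x : \sum_(i < n) a i * f x i = \sum_(i < n) a i * x i.
  by apply: eq_bigr => i _; rewrite ffunE.
exists [seq f x | x <- enum A]; split.
- by rewrite map_inj_uniq // enum_uniq.
- move=> x; apply/mapP/idP => [[y]|/eqP sum_x].
    by rewrite mem_enum inE => sum_y ->; rewrite sum_f.
  have x_le i : x i < l.+1.
    rewrite ltnS -sum_x (bigD1 i) //=.
    by apply: leq_trans (leq_addr _ _); rewrite leq_pmull.
  have fx : x = f [ffun i => Ordinal (x_le i)].
    by apply/ffunP => i; rewrite !ffunE.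
  by exists [ffun i => Ordinal (x_le i)] => //;
     rewrite mem_enum inE -sum_f -fx sum_x.
- by rewrite size_map -cardE.
Qed.

(* Main.v *)
Require Import Defs.
From mathcomp Require Import all_boot all_order all_algebra.

(** Put d_i = M / a_i and divide each unknown by d_i with remainder,
    x_i = y_i * d_i + z_i with z_i < d_i.  Since a_i * d_i = M,

      \sum_i a_i * x_i = M * (\sum_i y_i) + \sum_i a_i * z_i,

    so a solution of \sum_i a_i * x_i = b has \sum_i a_i * z_i congruent to b,
    that is to r, modulo M.  As a_i * z_i <= M - a_i, this weight is at most
    n * M - \sum_i a_i, and the hypothesis on the floor makes this
    bound smaller than r + M: the weight of z must be r itself, and
    then the y_i sum to b %/ M.  Solutions are therefore pairs (z, y)
    chosen independently ([denumerant_box]); stars and bars count the y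
    ([denumerant_ones]).

    It remains to count the z of weight r modulo M.  The box of all z is the
    group \prod_i Z / d_i, and the weight is a homomorphism to Z / M whose image
    is generated by the a_i, hence everything as the a_i are coprime.  So its M
    fibres have the same size, (\prod_i d_i) / M = M ^ (n - 1) / \prod_i a_i
    ([card_fibre]).  The formula for P(r) is the case b = r of that for P(b). *)

Set Implicit Arguments.
Unset Strict Implicit.
Unset Printing Implicit Defensive.

(** * Sequences that are periodic modulo M *)

Section Periodic.

Variables (M : nat) (c : nat -> nat).
Hypothesis M_gt0 : 0 < M.
Hypothesis cM : forall s, c (s %% M) = c s.

Let le_shift t := forall s, c s <= c (s + t).

Let le_shiftD t u : le_shift t -> le_shift u -> le_shift (t + u).
Proof. by move=> ht hu s; rewrite addnA (leq_trans (ht s)). Qed.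

Let le_shiftM k t : le_shift t -> le_shift (k * t).
Proof.
move=> ht; elim: k => [|k IHk]; first by move=> s; rewrite mul0n addn0.
by rewrite mulSn; apply: le_shiftD.
Qed.

(** By Bezout gcdn t u = k * t - l * u, and modulo M the subtraction of l * u is
    the addition of M.-1 * (l * u), so the shifts that do not decrease c are
    closed under gcd. *)
Let le_shift_gcd t u : le_shift t -> le_shift u -> le_shift (gcdn t u).
Proof.
move=> ht hu; case: (posnP t) => [->|t_gt0]; first by rewrite gcd0n.
case: (egcdnP u t_gt0) => k l def_k _ s.
have := le_shiftD (le_shiftM k ht) (le_shiftM M.-1 (le_shiftM l hu)) s.
suff -> : c (s + (k * t + M.-1 * (l * u))) = c (s + gcdn t u) by [].
have -> : s + (k * t + M.-1 * (l * u)) = l * u * M + (s + gcdn t u).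
  rewrite def_k -[in RHS](prednK M_gt0) mulnS (mulnC M.-1).
  by rewrite (addnAC (l * u)) addnCA.
by rewrite -[LHS]cM modnMDl cM.
Qed.

(** Going once around a period, a sequence that never decreases must be
    constant. *)
Lemma periodic_const n (a : 'I_n -> nat) :
    \big[gcdn/0]_(i < n) a i = 1 -> (forall i s, c s <= c (s + a i)) ->
  forall s, c s = c 0.
Proof.
move=> a_coprime c_le.
have c_le1 : le_shift 1.
  rewrite -a_coprime; elim/big_ind: _ => [s|t u|i _]; first by rewrite addn0.
    exact: le_shift_gcd.
  by move=> s; apply: c_le.
have c_leD t : le_shift t by rewrite -[t]muln1; apply: le_shiftM.
move=> s; apply/eqP; rewrite eqn_leq (c_leD s 0) andbT.
have := c_leD (M.-1 * s) s; rewrite -mulSn (prednK M_gt0).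
by rewrite -[X in _ <= X]cM modnMr.
Qed.

End Periodic.

(** * The box of remainders and its weight modulo M *)

Section Box.

Variables (n : nat) (a : 'I_n -> nat) (M : nat).
Hypothesis M_gt0 : 0 < M.
Hypothesis a_dvd : forall i, a i %| M.

Let d i := M %/ a i.

Let ad i : a i * d i = M. Proof. by rewrite mulnC divnK. Qed.

Let a_gt0 i : 0 < a i. Proof. exact: dvdn_gt0 (a_dvd i). Qed.

Let d_gt0 i : 0 < d i.
Proof. by rewrite divn_gt0 ?a_gt0 // dvdn_leq. Qed.

Definition box := {dffun forall i : 'I_n, 'I_(M %/ a i)}.

Definition weight (z : box) := \sum_(i < n) a i * z i.

Definition fibre s := [set z : box | weight z == s %[mod M]].

(** The coordinate wraps around modulo d_j, which changes the weight by
    a_j * d_j = M and is thus invisible modulo M. *)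
Let shift j (z : box) : box := [ffun i => if i == j then ordS (z i) else z i].

Let shift_inj j : injective (shift j).
Proof.
move=> z z' /ffunP eq_zz'; apply/ffunP => i; have := eq_zz' i.
by rewrite !ffunE; case: eqP => // _; apply: (can_inj (@ordSK _)).
Qed.

Let weight_shift j z : weight (shift j z) = weight z + a j %[mod M].
Proof.
rewrite /weight (bigD1 j) //= [in RHS](bigD1 j) //= ffunE eqxx /=.
rewrite [X in _ + X](eq_bigr (fun i => a i * z i)) => [|i /negPf ne_ij].
  by rewrite muln_modr [(a j * (M %/ a j))%N]ad modnDml mulnSr addnAC.
by rewrite /shift ffunE ne_ij.
Qed.

Let card_fibre_mod s : #|fibre (s %% M)| = #|fibre s|.
Proof. by apply: eq_card => z; rewrite !inE modn_mod. Qed.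

Let card_fibre_le j s : #|fibre s| <= #|fibre (s + a j)|.
Proof.
rewrite -(card_imset _ (shift_inj (j := j))).
apply/subset_leq_card/subsetP => _ /imsetP[z + ->]; rewrite !inE => /eqP def_s.
by rewrite weight_shift -modnDml def_s modnDml.
Qed.

Let card_box : #|{: box}| = \prod_(i < n) d i.
Proof.
rewrite card_dep_ffun foldrE big_map -big_enum /=.
by apply: eq_bigr => i _; rewrite card_ord.
Qed.

(** Shifting a coordinate embeds the fibre over s in the one over s + a_j, so the sizes of the
    fibres form a periodic sequence that no a_j-shift decreases. *)
Lemma card_fibre s : \big[gcdn/0]_(i < n) a i = 1 ->
  M * #|fibre s| = \prod_(i < n) (M %/ a i).
Proof.
move=> a_coprime; rewrite -[RHS]card_box.
have c_const := periodic_const M_gt0 card_fibre_mod a_coprime card_fibre_le.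
pose res (z : box) := Ordinal (ltn_pmod (weight z) M_gt0).
rewrite -[RHS]sum1_card [RHS](partition_big res xpredT) //=.
rewrite [RHS](eq_bigr (fun=> #|fibre s|)) => [|t _].
  by rewrite sum_nat_const card_ord.
rewrite sum1_card (c_const s) -(c_const t).
by apply: eq_card => z; rewrite inE [t %% M]modn_small.
Qed.

Lemma weight_bound z : weight z + \sum_(i < n) a i <= n * M.
Proof.
have -> : n * M = \sum_(i < n) M by rewrite sum_nat_const card_ord.
rewrite -big_split /=.
apply: leq_sum => i _; rewrite -mulnSr -[leqRHS](ad i) leq_mul2l.
apply/orP; right; exact: ltn_ord.
Qed.

(** * Division of a solution by the d_i *)

(** Euclidean division of each unknown by d_i is a bijection of the solutions
    onto the pairs of a box element in the fibre and a tuple of quotients; as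
    the weight of the former is exactly r, the latter sum to q whatever the
    remainders are, and the two choices are independent. *)
Lemma denumerant_box q r : (forall z, z \in fibre r -> weight z = r) ->
  denumerant a (q * M + r) = #|fibre r| * denumerant (fun _ : 'I_n => 1) q.
Proof.
move=> fibre_r; set b := q * M + r.
pose Y := [set y : {ffun 'I_n -> 'I_q.+1} | \sum_(i < n) 1 * y i == q].
pose recomb (u : box * {ffun 'I_n -> 'I_q.+1}) : {ffun 'I_n -> 'I_b.+1} :=
  [ffun i => inord (u.2 i * d i + u.1 i)].
have sum_recomb (y z : 'I_n -> nat) :
    \sum_(i < n) a i * (y i * d i + z i)
      = (\sum_(i < n) 1 * y i) * M + \sum_(i < n) a i * z i.
  rewrite big_distrl -big_split /=; apply: eq_bigr => i _.
  by rewrite mulnDr mul1n mulnCA ad.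
have sum_le (x : 'I_n -> nat) : \sum_(i < n) a i * x i = b -> forall i, x i <= b.
  move=> <- i; rewrite (bigD1 i) //=.
  by apply: leq_trans (leq_addr _ _); rewrite leq_pmull.
(* a recombined pair is a solution, so its entries are at most b and the
   truncation by inord is the identity on them *)
have recombE z y : z \in fibre r -> y \in Y ->
    forall i, recomb (z, y) i = y i * d i + z i :> nat.
  move=> /fibre_r wz; rewrite inE => /eqP sum_y i; rewrite ffunE inordK // ltnS.
  apply: (sum_le (fun i => y i * d i + z i)) i.
  by rewrite sum_recomb sum_y [X in _ + X]wz.
rewrite -[denumerant _ q]/#|Y| -cardsX /denumerant.
have recomb_inj : {in setX (fibre r) Y &, injective recomb}.
  move=> [z y] [z' y'] /setXP[zr yY] /setXP[z'r y'Y] eq_x.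
  have eq_i i : y i * d i + z i = y' i * d i + z' i.
    by rewrite -!recombE // eq_x.
  congr (_, _); apply/ffunP => i; apply/val_inj => /=.
    by have := congr1 (modn^~ (d i)) (eq_i i); rewrite !modnMDl !modn_small.
  have := congr1 (divn^~ (d i)) (eq_i i).
  by rewrite !divnMDl // !divn_small // !addn0.
rewrite -(card_in_imset recomb_inj); apply: eq_card => x.
apply/idP/imsetP => [|[[z y] /setXP[zr yY] ->]]; rewrite inE; last first.
  rewrite (eq_bigr _ (fun i _ => congr1 (muln (a i)) (recombE z y zr yY i))).
  by move: yY; rewrite inE sum_recomb [X in _ + X](fibre_r z zr) => /eqP->.
move=> /eqP sum_x.
pose z : box := [ffun i => Ordinal (ltn_pmod (x i) (d_gt0 i))].
have wz : weight z = \sum_(i < n) a i * (x i %% d i).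
  by apply: eq_bigr => i _; rewrite ffunE.
have sum_div : (\sum_(i < n) 1 * (x i %/ d i)) * M + weight z = b.
  by rewrite wz -sum_recomb -[RHS]sum_x; apply: eq_bigr => i _; rewrite -divn_eq.
have zr : z \in fibre r by rewrite inE -(modnMDl q r) -/b -sum_div modnMDl.
have sum_q : \sum_(i < n) 1 * (x i %/ d i) = q.
  apply/eqP; rewrite -(eqn_pmul2r M_gt0) -(eqn_add2r r).
  by rewrite -{1}(fibre_r z zr) sum_div.
have y_le i : x i %/ d i < q.+1.
  by rewrite ltnS -sum_q (bigD1 i) //= mul1n leq_addr.
pose y : {ffun 'I_n -> 'I_q.+1} := [ffun i => Ordinal (y_le i)].
have yY : y \in Y.
  by rewrite inE -[X in _ == X]sum_q; apply/eqP/eq_bigr => i _; rewrite ffunE.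
exists (z, y); first exact/setXP.
by apply/ffunP => i; apply/val_inj; rewrite /= recombE // !ffunE /= -divn_eq.
Qed.

End Box.

(** Stars and bars, transported from tuples to finite functions. *)
Lemma denumerant_ones m q : denumerant (fun _ : 'I_m.+1 => 1) q = 'C(m + q, m).
Proof.
rewrite -card_ord_partitions.
pose f (x : {ffun 'I_m.+1 -> 'I_q.+1}) := [tuple x i | i < m.+1].
have f_inj : injective f.
  move=> x y eq_xy; apply/ffunP => i.
  by have := congr1 (fun t => tnth t i) eq_xy; rewrite !tnth_mktuple.
rewrite /denumerant -(card_imset _ f_inj); apply: eq_card => t.
have sum_t : \sum_(i <- t) i = \sum_(i < m.+1) 1 * tnth t i.
  by rewrite big_tuple; apply: eq_bigr => i _; rewrite mul1n.
rewrite [RHS]inE sum_t; apply/imsetP/eqP => [[x + ->]|sum_q].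
  rewrite inE => /eqP sum_x; rewrite -[RHS]sum_x; apply: eq_bigr => i _.
  by rewrite tnth_mktuple.
exists [ffun i => tnth t i].
  by rewrite inE -[X in _ == X]sum_q; apply/eqP/eq_bigr => i _; rewrite ffunE.
by apply: eq_from_tnth => i; rewrite tnth_mktuple ffunE.
Qed.

(** * The formula *)

Import Order.TTheory GRing.Theory Num.Theory.

Local Open Scope ring_scope.

Lemma floor0_bound (n s M : nat) : (0 < M)%N ->
  Num.floor (n%:R - s%:R / M%:R : rat) = 0 -> (n * M < s + M)%N.
Proof.
move=> M_gt0 floor0; have := floorD1_gt (n%:R - s%:R / M%:R : rat).
have M_gt0' : 0 < M%:R :> rat by rewrite ltr0n.
rewrite floor0 add0r ltrBlDr -(ltr_pM2r M_gt0') mulrDl divfK ?gt_eqF //.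
by rewrite mul1r -natrM -natrD ltr_nat addnC.
Qed.

Theorem theorem3p3 (n : nat) (a : 'I_n -> nat) (b M r : nat)
    (n_gt0 : (0 < n)%N)
    (a_gt0 : forall i : 'I_n, (0 < a i)%N)
    (a_coprime : \big[gcdn/0%N]_(i < n) a i = 1%N)
    (defM : M = \big[lcmn/1%N]_(i < n) a i)
    (defr : r = (b %% M)%N)
    (floor0 : Num.floor (n%:R - ((\sum_(i < n) a i) + r)%N%:R / M%:R : rat) = 0) :
  (denumerant a r)%:R = M%:R ^+ n.-1 / \prod_(i < n) (a i)%:R :> rat
  /\ (denumerant a b)%:R
       = M%:R ^+ n.-1 / \prod_(i < n) (a i)%:R
         * 'C(b %/ M + n - 1, n - 1)%:R :> rat.
Proof.
have M_gt0 : (0 < M)%N.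
  rewrite defM; elim/big_ind: _ => // u v u_gt0 v_gt0.
  by rewrite lcmn_gt0 u_gt0.
have a_dvd i : (a i %| M)%N by rewrite defM (biglcmn_sup i).
have r_lt : (r < M)%N by rewrite defr ltn_mod.
have fibre_r (z : box a M) : z \in fibre a M r -> weight z = r.
  have wz_lt : (weight z < r + M)%N.
    have := leq_ltn_trans (weight_bound a_dvd z) (floor0_bound M_gt0 floor0).
    by rewrite -addnA addnC ltn_add2l.
  rewrite inE (modn_small r_lt) => /eqP wz_mod.
  have := divn_eq (weight z) M; rewrite wz_mod.
  (* the quotient is 0, for otherwise the weight would be at least r + M *)
  case: (weight z %/ M)%N => [|k]; first by rewrite mul0n.
  by move=> wz; move: wz_lt; rewrite wz addnC ltn_add2l mulSn ltnNge leq_addr.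
have denumE q : denumerant a (q * M + r)
    = (#|fibre a M r| * 'C(q + n - 1, n - 1))%N.
  rewrite (denumerant_box M_gt0 a_dvd) //; congr (_ * _)%N.
  case: n n_gt0 {a a_gt0 a_coprime defM floor0 a_dvd fibre_r} => // m _.
  by rewrite denumerant_ones addnS !subn1 /= addnC.
have fibreE : (#|fibre a M r|)%:R = M%:R ^+ n.-1 / \prod_(i < n) (a i)%:R :> rat.
  have prod_neq0 : \prod_(i < n) (a i)%:R != 0 :> rat.
    by apply/prodf_neq0 => i _; rewrite pnatr_eq0 -lt0n.
  apply: (canRL (mulfK prod_neq0)); rewrite -natr_prod -natrM -natrX.
  congr (_%:R); apply/eqP; rewrite -(eqn_pmul2l M_gt0) mulnA -expnS prednK //.
  have -> : (M ^ n = \prod_(i < n) M)%N by rewrite prod_nat_const card_ord.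
  rewrite card_fibre // -big_split /=.
  by apply/eqP/eq_bigr => i _; rewrite divnK.
split; last by rewrite {1}(divn_eq b M) -defr denumE natrM fibreE.
by rewrite -fibreE -[r in LHS]add0n -[0%N](mul0n M) denumE add0n binn muln1.
Qed.
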